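(* Let $q\geq 3$ be a prime power. Then: (1) $M_2(q^2-2)=\dfrac{q^2+q}{2}$; (2) if $q$ is even and $q\geq 8$, then for each odd integer $k$ with $3\leq k\leq q-3$, $M_2(q^2-k-1)=\dfrac{q^2+q-k+1}{2}$; (3) if $q$ is even, then $M_2((q-1)^2-2)=\dfrac{(q-1)^2+q-3}{2}+1$; (4) if $q$ is odd, then for each even integer $k$ with $2\leq k\leq 2\lceil q/4\rceil$, $M_2(q^2-k)=\dfrac{q^2+q-k}{2}+1$.
   Context: For integers $c,s\geq 1$, $K_{c\times s}$ denotes the complete multipartite graph with $c$ classes of $s$ vertices each. For a subgraph $H$ of $K_{c\times s}$, $\overline{H}$ denotes the complement of $H$ relative to $K_{c\times s}$. $C_4$ is the $4$-cycle and $K_{1,n}$ is the star with $n+1$ vertices. $M_s(n)$ is the smallest positive integer $c$ such that for every subgraph $H$ of $K_{c\times s}$, $H$ contains a copy of $C_4$ or $\overline{H}$ contains a copy of $K_{1,n}$. *)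

(* Defs.v *)
From mathcomp Require Import all_boot.

Set Implicit Arguments.
Unset Strict Implicit.
Unset Printing Implicit Defensive.

Definition prime_power (q : nat) : Prop :=
  exists p m : nat, [/\ prime p, 0 < m & q = p ^ m].

Definition ceil_divn (m d : nat) : nat := (m + d.-1) %/ d.

(* Graphs are given by their adjacency relations. [contains_copy F G] : G has a
   (not necessarily induced) subgraph isomorphic to F. *)
Definition contains_copy (V W : finType) (F : rel V) (G : rel W) : Prop :=
  exists f : V -> W, injective f /\ forall x y, F x y -> G (f x) (f y).

Definition C4 : rel 'I_4 :=
  fun i j => (j == i.+1 %% 4 :> nat) || (i == j.+1 %% 4 :> nat).

(* K_{1,n}, with centre 0 and leaves 1, ..., n. *)
Definition star (n : nat) : rel 'I_n.+1 :=
  fun i j => (i == ord0) (+) (j == ord0).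
Arguments star n : clear implicits.

(* K_{c x s}: the vertex (i, j) is the j-th vertex of the i-th class. *)
Definition Kmult (c s : nat) : rel ('I_c * 'I_s) := fun x y => x.1 != y.1.
Arguments Kmult c s : clear implicits.

(* Subgraphs are taken on the whole vertex set, so that H and its relative
   complement partition the edges of K_{c x s}. *)
Definition subgraph_Kmult (c s : nat) (H : rel ('I_c * 'I_s)) : Prop :=
  symmetric H /\ subrel H (Kmult c s).

Definition rel_compl (c s : nat) (H : rel ('I_c * 'I_s)) : rel ('I_c * 'I_s) :=
  fun x y => Kmult c s x y && ~~ H x y.

Definition arrows (s n c : nat) : Prop :=
  forall H : rel ('I_c * 'I_s), subgraph_Kmult H ->
    contains_copy C4 H \/ contains_copy (star n) (rel_compl H).

(* [is_M s n c] reads M_s(n) = c: the minimum exists and equals c. *)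
Definition is_M (s n c : nat) : Prop :=
  [/\ 0 < c, arrows s n c & forall c', 0 < c' -> arrows s n c' -> c <= c'].

(* Main.v *)
(** The ends, other than its origin, of the 2-paths leaving a vertex of a
    [C4]-free graph are distinct, so minimum degree [d] forces more than
    [d (d - 1)] vertices; this gives the upper bounds.

    For the lower bounds, delete points from the polarity graph of [PG(2, q)]
    attached to the form [x x' - y z' - z y'], which is [C4]-free and almost
    [(q + 1)]-regular. In (1), (2) and (4), delete up to [q] points of a
    parabola: a polar line contains at most two of them, and at most one if its
    pole is absolute, so that all degrees remain at least [q - 1]. In (3), [q]
    is even, the absolute points form a line, and one deletes this line, its
    pole and the [q + 1] points of a conic disjoint from it; each vertex that
    is left loses one neighbour on the absolute line and at most two on the
    conic, hence keeps degree at least [q - 2].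

    Finally, a graph of maximum degree less than half its order has a perfect
    matching in its complement, which provides the classes of [K_{c x 2}]. *)

Require Import Defs.
From mathcomp Require Import all_boot all_fingroup all_algebra all_field.
From mathcomp Require Import zify ring.

Set Implicit Arguments.
Unset Strict Implicit.
Unset Printing Implicit Defensive.

(** * Finite sets *)

Lemma card_preimset_inj (T V : finType) (f : T -> V) (A : {set V}) :
  injective f -> #|f @^-1: A| = #|A :&: f @: setT|.
Proof.
move=> injf; rewrite -(card_imset _ injf); apply: eq_card => v.
rewrite inE; apply/imsetP/andP => [[x]|[Av /imsetP [x _ vE]]].
  by rewrite inE => Afx ->; rewrite imset_f.
by exists x; rewrite // inE -vE.
Qed.

Lemma leq_card_setI_imset (T V : finType) (f : T -> V)
    (A : {set V}) (B : {set T}) :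
  #|A :&: f @: B| <= #|f @^-1: A|.
Proof.
apply: leq_trans (leq_imset_card f _); apply/subset_leq_card/subsetP => v.
by rewrite inE => /andP [Av /imsetP [x _ vE]]; rewrite vE imset_f ?inE -?vE.
Qed.

Lemma card_set_option (T : finType) (A : {set option T}) :
  #|A| = #|Some @^-1: A| + (None \in A).
Proof.
have Some_inj : injective (@Some T) by move=> x y [].
rewrite (cardsD1 None) addnC -(card_imset _ Some_inj); congr (_ + _).
apply: eq_card => -[x|]; rewrite !inE /= ?mem_imset ?inE //.
by apply/esym/imsetP => -[].
Qed.

Lemma exists_enumeration (T V : finType) (W : {set V}) :
  #|T| = #|W| -> exists2 f : T -> V, injective f & f @: setT = W.
Proof.
move=> cardT; pose f x := enum_val (cast_ord cardT (enum_rank x)).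
have injf : injective f.
  by move=> x y /enum_val_inj /cast_ord_inj /enum_rank_inj.
exists f => //; apply/eqP.
rewrite eqEcard card_imset // cardsT cardT leqnn andbT.
by apply/subsetP => _ /imsetP [x _ ->]; apply: enum_valP.
Qed.

(** * Degrees, 4-cycles and stars *)

Section Graphs.
Variable V : finType.
Implicit Types (E : rel V) (u v w x : V).

Definition nbrs E v : {set V} := [set w | E v w].

Definition C4_free E : bool :=
  [forall u, forall v, (u != v) ==> (#|nbrs E u :&: nbrs E v| <= 1)].

Lemma C4_freeP E :
  reflect (forall u v, u != v -> #|nbrs E u :&: nbrs E v| <= 1) (C4_free E).
Proof.
apply: (iffP forallP) => [freeE u v|freeE u].
  by have /forallP/(_ v)/implyP := freeE u.
by apply/forallP => v; apply/implyP; apply: freeE.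
Qed.

Lemma C4_free_sub E E' : subrel E E' -> C4_free E' -> C4_free E.
Proof.
move=> subE /C4_freeP freeE'; apply/C4_freeP => u v uv.
apply: leq_trans (freeE' u v uv); apply/subset_leq_card/setISS;
  by apply/subsetP => w; rewrite !inE; apply: subE.
Qed.

Lemma contains_C4P E : symmetric E -> irreflexive E ->
  reflect (contains_copy C4 E) (~~ C4_free E).
Proof.
move=> symE irrE; apply: (iffP idP) => [|[f [injf fE]]].
  rewrite negb_forall => /existsP [u]; rewrite negb_forall => /existsP [x].
  rewrite negb_imply -ltnNge => /andP [ux /card_gt1P [v [w [+ + vw]]]].
  rewrite !inE => /andP [uv xv] /andP [uw xw].
  have adj_neq a b : E a b -> a != b by apply: contraTneq => ->; rewrite irrE.
  exists (fun i : 'I_4 => nth u [:: u; v; x; w] i); split.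
    have uniq_cycle : uniq [:: u; v; x; w].
      by rewrite /= !inE !negb_or ux vw !adj_neq //= symE.
    by move=> i j /eqP; rewrite nth_uniq // => /eqP /val_inj.
  by move=> [[|[|[|[|//]]]] ?] [[|[|[|[|//]]]] ?] //= _; rewrite // symE.
pose o (i : nat) (lti4 : i < 4) : 'I_4 := Ordinal lti4.
apply/negP => /C4_freeP/(_ (f (@o 0 isT)) (f (@o 2 isT))).
rewrite (inj_eq injf) => /(_ isT); rewrite leqNgt => /negP; apply.
apply/card_gt1P.
by exists (f (@o 1 isT)), (f (@o 3 isT)); rewrite !inE !fE // (inj_eq injf).
Qed.

Lemma contains_starP E n : symmetric E -> irreflexive E ->
  reflect (contains_copy (star n) E) [exists v, n <= #|nbrs E v|].
Proof.
move=> symE irrE; apply: (iffP existsP) => [[v len]|[f [injf fE]]]; last first.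
  exists (f ord0); rewrite -[X in X <= _]card_ord.
  rewrite -(card_imset _ (inj_comp injf (@lift_inj _ ord0))).
  apply: subset_leq_card; apply/subsetP=> _ /imsetP [i _ ->].
  by rewrite inE; apply: fE; rewrite /star eqxx eq_sym (negPf (neq_lift _ _)).
pose leaf (i : 'I_n) : V := enum_val (widen_ord len i).
have leafE i : E v (leaf i) by have := enum_valP (widen_ord len i); rewrite inE.
have leaf_inj : injective leaf.
  by move=> i j /enum_val_inj /(congr1 val) /= eij; apply: val_inj.
have leaf_neq i : (leaf i == v) = false.
  by apply: contraTF (leafE i) => /eqP ->; rewrite irrE.
exists (fun i => if unlift ord0 i is Some j then leaf j else v); split=> i j.
  case: unliftP => [i'|] ->; case: unliftP => [j'|] -> //.
  - by move=> /leaf_inj ->.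
  - by move/eqP; rewrite leaf_neq.
  - by move/esym/eqP; rewrite leaf_neq.
rewrite /star; case: unliftP => [i'|] ->; case: unliftP => [j'|] ->;
  by rewrite ?eqxx ?[lift _ _ == _]eq_sym ?(negPf (neq_lift _ _)) //= symE.
Qed.

Lemma C4_free_min_degree E (d : nat) v : symmetric E -> C4_free E ->
  (forall x, d <= #|nbrs E x|) -> d * d.-1 < #|V|.
Proof.
move=> symE /C4_freeP freeE degE.
have paths_ge : d * d.-1 <= \sum_(w in nbrs E v) #|nbrs E w :\ v|.
  apply: (@leq_trans (\sum_(w in nbrs E v) d.-1)).
    by rewrite sum_nat_const leq_mul.
  apply: leq_sum => w; rewrite inE symE => vw.
  by have := degE w; rewrite (cardsD1 v) inE vw; lia.
have paths_le : \sum_(w in nbrs E v) #|nbrs E w :\ v| <= #|[set~ v]|.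
  under eq_bigr => w _ do rewrite -sum1_card.
  rewrite (exchange_big_dep (mem [set~ v])) /=; last first.
    by move=> w x _; rewrite !inE => /andP [].
  rewrite -sum1_card; apply: leq_sum => x; rewrite !inE eq_sym => vx.
  rewrite sum1_card; apply: leq_trans (freeE v x vx).
  apply: subset_leq_card; apply/subsetP => w.
  by rewrite unfold_in !inE => /andP [-> /andP [_]]; rewrite symE.
have := leq_trans paths_ge paths_le; rewrite cardsC1 => le_paths.
by rewrite (leq_ltn_trans le_paths) // ltn_predL; apply/card_gt0P; exists v.
Qed.

End Graphs.

Lemma nbrs_relpre (T V : finType) (f : T -> V) (E : rel V) (x : T) :
  nbrs (relpre f E) x = f @^-1: nbrs E (f x).
Proof. by apply/setP => y; rewrite !inE. Qed.

Lemma C4_free_relpre (T V : finType) (f : T -> V) (E : rel V) :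
  injective f -> C4_free E -> C4_free (relpre f E).
Proof.
move=> injf /C4_freeP freeE; apply/C4_freeP => u v uv.
rewrite 2!nbrs_relpre -preimsetI card_preimset_inj //.
apply: leq_trans (subset_leq_card (subsetIl _ _)) _.
by apply: freeE; rewrite (inj_eq injf).
Qed.

(** * Complete multipartite graphs *)

Section Multipartite.
Variables s n c : nat.
Implicit Types H : rel ('I_c * 'I_s).

Lemma Kmult_irreflexive H : subrel H (Kmult c s) -> irreflexive H.
Proof. by move=> subH x; apply/negP => /subH; rewrite /Kmult eqxx. Qed.

Lemma rel_compl_symmetric H : symmetric H -> symmetric (rel_compl H).
Proof. by move=> symH x y; rewrite /rel_compl symH /Kmult eq_sym. Qed.

Lemma rel_compl_irreflexive H : irreflexive (rel_compl H).
Proof. by apply: Kmult_irreflexive => x y /andP []. Qed.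

Lemma card_nbrs_Kmult x : #|nbrs (Kmult c s) x| = c.-1 * s.
Proof.
have -> : nbrs (Kmult c s) x = setX [set~ x.1] setT.
  by apply/setP => y; rewrite !inE andbT eq_sym.
by rewrite cardsX cardsC1 cardsT !card_ord.
Qed.

Lemma card_nbrs_rel_compl H x : subrel H (Kmult c s) ->
  #|nbrs H x| + #|nbrs (rel_compl H) x| = c.-1 * s.
Proof.
move=> subH; rewrite -(card_nbrs_Kmult x).
rewrite -(cardsID (nbrs H x) (nbrs (Kmult c s) x)).
congr (_ + _); apply: eq_card => y; rewrite !inE; last by rewrite andbC.
by case: (boolP (H x y)) => [/subH ->|_]; rewrite ?andbF.
Qed.

Lemma arrows_of_degree d : 0 < c -> 0 < s ->
  d + n <= (c.-1 * s).+1 -> c * s <= d * d.-1 -> arrows s n c.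
Proof.
move=> c0 s0 led lecs H [symH subH].
have irrH := Kmult_irreflexive subH.
have symC := rel_compl_symmetric symH; have irrC := @rel_compl_irreflexive H.
have [freeH|/(contains_C4P symH irrH)] := boolP (C4_free H); last by left.
right; apply/(contains_starP _ symC irrC); apply: contraT.
rewrite negb_exists => /forallP degC.
have degH x : d <= #|nbrs H x|.
  by have := degC x; have := card_nbrs_rel_compl x subH; lia.
have := C4_free_min_degree (Ordinal c0, Ordinal s0) symH freeH degH.
by rewrite card_prod !card_ord; lia.
Qed.

Lemma arrows_leq d : c <= d -> arrows s n c -> arrows s n d.
Proof.
move=> lecd arr H [symH subH].
pose f (x : 'I_c * 'I_s) : 'I_d * 'I_s := (widen_ord lecd x.1, x.2).
have injf : injective f.
  by move=> [x1 x2] [y1 y2] [/= e1 ->]; congr pair; apply: val_inj.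
have [|[g [injg gH]]|[g [injg gH]]] := arr (relpre f H).
- by split=> [x y|x y /subH //]; apply: symH.
- by left; exists (f \o g); split=> [|x y /gH //]; apply: inj_comp.
- by right; exists (f \o g); split=> [|x y /gH //]; apply: inj_comp.
Qed.

End Multipartite.

Lemma is_M_intro (s n c : nat) :
  1 < c -> arrows s n c -> ~ arrows s n c.-1 -> is_M s n c.
Proof.
move=> c1 arr narr; split=> // [|c' _ arr']; first by lia.
rewrite leqNgt; apply/negP => ltc; apply: narr.
by apply: arrows_leq arr'; lia.
Qed.

(** * Perfect matchings in the complement of a sparse graph *)

Section PerfectMatching.
Variables (T : finType) (s : T -> T) (D : nat).
Hypotheses (sK : involutive s) (s_neq : forall x, s x != x).
Hypothesis ltD : 2 * D < #|T|.

(* [s u] violates both non-adjacency conditions, so that fewer than [2 D]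
   vertices violate one of them. *)
Lemma exists_exchange_partner (E : rel T) (u : T) :
  symmetric E -> (forall x, #|nbrs E x| <= D) -> E u (s u) ->
  exists w, [/\ w != u, ~~ E u w & ~~ E (s u) (s w)].
Proof.
move=> symE degE adj_u; set B := nbrs E u; set C := s @^-1: nbrs E (s u).
have BC_gt0 : 0 < #|B :&: C|.
  by apply/card_gt0P; exists (s u); rewrite !inE adj_u sK symE.
have cardC : #|C| = #|nbrs E (s u)| by rewrite card_preimset //; apply: inv_inj.
have /subsetPn [w _] : ~~ ([set: T] \subset u |: (B :|: C)).
  apply: contraL ltD => /subset_leq_card; rewrite cardsT -leqNgt => leT.
  have := cardsUI B C; have := degE u; have := degE (s u); rewrite -cardC.
  by move: leT; rewrite cardsU1; case: (_ \notin _); rewrite -/B; lia.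
by rewrite !inE !negb_or => /and3P [wu nadj_uw nadj_sw]; exists w.
Qed.

Lemma exchange_increases_matching (E : rel T) (u : T) :
  symmetric E -> (forall x, #|nbrs E x| <= D) -> E u (s u) ->
  exists g : {perm T},
    [set x | ~~ E x (s x)] \proper [set x | ~~ E (g x) (g (s x))].
Proof.
move=> symE degE adj_u.
have [w [wu nadj_uw nadj_sw]] := exists_exchange_partner symE degE adj_u.
have w_su : w != s u by apply: contraNneq nadj_uw => ->.
have inj_s : injective s := inv_inj sK.
pose g := tperm (s u) w.
have gu : g u = u by rewrite tpermD // eq_sym.
have gsw : g (s w) = s w.
  by rewrite tpermD // eq_sym // (inj_eq inj_s).
have nadj_s x : ~~ E (g x) (g (s x)) -> ~~ E (g (s x)) (g (s (s x))).
  by rewrite sK symE.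
have nadj_u : ~~ E (g u) (g (s u)) by rewrite gu tpermL.
have nadj_w : ~~ E (g w) (g (s w)) by rewrite gsw tpermR.
exists g; apply/properP; split; last by exists u; rewrite inE ?adj_u.
apply/subsetP => x; rewrite !inE => nx.
have [->//|xu] := eqVneq x u; have [->//|xw] := eqVneq x w.
have [->|xsu] := eqVneq x (s u); first exact: nadj_s.
have [->|xsw] := eqVneq x (s w); first exact: nadj_s.
have sxw : s x != w by rewrite -(inj_eq inj_s) sK.
by rewrite !tpermD // eq_sym ?(inj_eq inj_s).
Qed.

Lemma perfect_matching_compl (E : rel T) :
  symmetric E -> (forall x, #|nbrs E x| <= D) ->
  exists g : {perm T}, forall x, ~~ E (g x) (g (s x)).
Proof.
move=> symE degE.
pose matched (g : {perm T}) := [set x | ~~ E (g x) (g (s x))].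
have [g _ g_max] :=
  @arg_maxnP _ (1%g : {perm T}) xpredT (fun g => #|matched g|) isT.
exists g => x; apply/negP => adj_x.
have [||t /proper_card] :=
  @exchange_increases_matching (relpre g E) x _ _ adj_x.
- by move=> y z; apply: symE.
- move=> y; rewrite nbrs_relpre card_preimset //; exact: perm_inj.
suff -> : [set y | ~~ relpre g E (t y) (t (s y))] = matched (t * g)%g.
  by rewrite ltnNge => /negP []; apply: g_max.
by apply/setP => y; rewrite !inE !permM.
Qed.

End PerfectMatching.

Section Pairs.
Variable c : nat.

Definition partner (x : 'I_c * 'I_2) : 'I_c * 'I_2 := (x.1, rev_ord x.2).

Lemma partnerK : involutive partner.
Proof. by move=> [x1 x2]; rewrite /partner /= rev_ordK. Qed.

Lemma partner_neq x : partner x != x.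
Proof. by case: x => [x1 [[|[|//]] ?]]; rewrite /partner xpair_eqE eqxx. Qed.

Lemma same_class x y : x.1 = y.1 -> y = x \/ y = partner x.
Proof.
case: x y => [x1 [[|[|//]] ?]] [y1 [[|[|//]] ?]] /= <-;
  [left | right | right | left]; by congr pair; apply: val_inj.
Qed.

End Pairs.

Lemma not_arrows_of_C4_free (V : finType) (E : rel V) (W : {set V})
    (n c d D : nat) :
  symmetric E -> irreflexive E -> C4_free E ->
  #|W| = 2 * c -> D < c -> 2 * c <= (n + d).+1 ->
  (forall v, v \in W -> d <= #|nbrs E v :&: W| <= D) -> ~ arrows 2 n c.
Proof.
move=> symE irrE freeE cardW ltDc len degE arr.
have [f injf fW] : exists2 f : 'I_c * 'I_2 -> V, injective f & f @: setT = W.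
  by apply: exists_enumeration; rewrite card_prod !card_ord cardW mulnC.
have degf x : d <= #|nbrs (relpre f E) x| <= D.
  by rewrite nbrs_relpre card_preimset_inj // fW degE // -fW imset_f.
have [|||g gP] := @perfect_matching_compl _ _ D (@partnerK c) (@partner_neq c)
                    _ (relpre f E).
- by rewrite card_prod !card_ord mulnC ltn_pmul2r.
- by move=> x y; apply: symE.
- by move=> x; case/andP: (degf x).
pose H := relpre (f \o g) E.
have symH : symmetric H by move=> x y; apply: symE.
have irrH : irreflexive H by move=> x; apply: irrE.
have subH : subrel H (Kmult c 2).
  move=> x y Hxy; apply/eqP => /same_class [] eyx; move: Hxy; rewrite eyx.
    by rewrite irrH.
  by apply/negP; apply: gP.
have symC := rel_compl_symmetric symH.
have irrC := @rel_compl_irreflexive _ _ H.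
have [//|/(contains_C4P symH irrH)|] := arr H.
  by rewrite C4_free_relpre //; apply: inj_comp injf perm_inj.
move/(contains_starP _ symC irrC)/existsP => [x].
have := card_nbrs_rel_compl x subH.
have -> : nbrs H x = g @^-1: nbrs (relpre f E) (g x) by rewrite -nbrs_relpre.
rewrite card_preimset; last exact: perm_inj.
by have /andP [+ _] := degf (g x); have := ltn_ord x.1; lia.
Qed.

(** * Roots of quadratics *)

Import GRing.Theory.
Local Open Scope ring_scope.

Lemma quadratic_root_sum (R : idomainType) (a b c s t : R) : s != t ->
  a * s ^+ 2 + b * s + c = 0 -> a * t ^+ 2 + b * t + c = 0 -> a * (s + t) = - b.
Proof.
rewrite -subr_eq0 => st0 root_s root_t; apply: (mulIf st0); apply/eqP.
rewrite -subr_eq0; apply/eqP; rewrite -[RHS](subr0 0) -{1}root_s -root_t; ring.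
Qed.

Section QuadraticRoots.
Variables (F : finIdomainType) (a b c : F).
Hypothesis a0 : a != 0.

Let roots : {set F} := [set t | a * t ^+ 2 + b * t + c == 0].

Lemma card_quadratic_roots : (#|roots| <= 2)%N.
Proof.
rewrite leqNgt; apply/card_gt2P => -[r [s [t [[]]]]].
rewrite !inE => /eqP root_r /eqP root_s /eqP root_t [rs st tr].
have /(mulfI a0) : a * (r + s) = a * (r + t).
  rewrite (quadratic_root_sum rs root_r root_s).
  by rewrite (quadratic_root_sum _ root_r root_t) // eq_sym.
by move/addrI/eqP; rewrite (negPf st).
Qed.

Lemma card_quadratic_double_root : b ^+ 2 = 4 * a * c -> (#|roots| <= 1)%N.
Proof.
move=> disc0; rewrite leqNgt; apply/card_gt1P => -[s [t []]].
rewrite !inE => /eqP root_s /eqP root_t st.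
have sum_st := quadratic_root_sum st root_s root_t.
have : (a * (s - t)) ^+ 2 == 0.
  have -> : (a * (s - t)) ^+ 2 = (a * (s + t)) ^+ 2
      - 4 * a * s * (a * (s + t) + b) + 4 * a * (a * s ^+ 2 + b * s + c)
      - 4 * a * c by ring.
  by rewrite root_s sum_st sqrrN disc0; apply/eqP; ring.
by rewrite sqrf_eq0 mulf_eq0 (negPf a0) subr_eq0 (negPf st).
Qed.

End QuadraticRoots.

(** * The orthogonal polarity of the projective plane *)

(* The points [(x, y, 1)], [(1, m, 0)] and [(0, 1, 0)] of the projective plane
   are represented by [inl (x, y)], [inr (Some m)] and [inr None]. *)
Definition point (F : finType) : finType := (F * F + option F)%type.

Section Polarity.
Variable F : finFieldType.
Implicit Types P Q R S : point F.

(* The vanishing of the form [x x' - y z' - z y']. *)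
Definition conjugate_pt P Q : bool :=
  match P, Q with
  | inl (x, y), inl (x', y') => y + y' == x * x'
  | inl (x, _), inr (Some m) | inr (Some m), inl (x, _) => x == m
  | inr None, inr _ | inr _, inr None => true
  | _, _ => false
  end.

Definition polar P : {set point F} := nbrs conjugate_pt P.

Lemma conjugate_pt_symmetric : symmetric conjugate_pt.
Proof.
by move=> [[x y]|[m|]] [[x' y']|[m'|]] //=; rewrite addrC mulrC.
Qed.

Lemma affine_conjugate_common (x y x' y' a b a' b' : F) :
  [/\ y + b = x * a, y' + b = x' * a, y + b' = x * a' & y' + b' = x' * a'] ->
  (x, y) = (x', y') \/ (a, b) = (a', b').
Proof.
move=> [PR QR PS QS].
have : (x - x') * (a - a') == 0.
  have -> : (x - x') * (a - a') = x * a - x' * a - (x * a' - x' * a') by ring.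
  by rewrite -PR -QR -PS -QS; apply/eqP; ring.
rewrite mulf_eq0 !subr_eq0 => /orP [/eqP xx'|/eqP aa'].
  by left; congr pair => //; apply: (@addIr _ b); rewrite PR QR xx'.
by right; congr pair => //; apply: (@addrI _ y); rewrite PR PS aa'.
Qed.

Lemma conjugate_pt_common P Q R S :
  conjugate_pt P R -> conjugate_pt Q R ->
  conjugate_pt P S -> conjugate_pt Q S -> P = Q \/ R = S.
Proof.
case: P => [[x y]|[m|]]; case: Q => [[x' y']|[m'|]];
  case: R => [[a b]|[k|]]; case: S => [[a' b']|[k'|]] //=;
  do 4?[move/eqP => ? | move=> _]; subst; try by [left | right].
- have [|[-> ->]|[-> ->]] := @affine_conjugate_common x y x' y' a b a' b';
    by [|left|right].
- by left; congr (inl (_, _)); apply: (@addIr _ b); transitivity (k' * a).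
- by left; congr (inl (_, _)); apply: (@addIr _ b'); transitivity (k * a').
- by right; congr (inl (_, _)); apply: (@addrI _ y); transitivity (x * m').
- by right; congr (inl (_, _)); apply: (@addrI _ y'); transitivity (x' * m).
Qed.

Lemma conjugate_pt_C4_free : C4_free conjugate_pt.
Proof.
apply/C4_freeP => P Q /eqP PQ; apply/card_le1_eqP => R S.
rewrite !inE => /andP [PR QR] /andP [PS QS].
by have [/PQ|->] := conjugate_pt_common PR QR PS QS.
Qed.

Definition polar_point P (o : option F) : point F :=
  match P, o with
  | inl (x, y), Some t => inl (t, x * t - y)
  | inl (x, _), None => inr (Some x)
  | inr (Some m), Some t => inl (m, t)
  | inr None, Some m => inr (Some m)
  | inr _, None => inr None
  end.

Lemma polarE P : polar P = polar_point P @: setT.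
Proof.
apply/setP => Q; rewrite inE; apply/idP/imsetP => [|[o _ ->]].
  case: P => [[x y]|[m|]]; case: Q => [[x' y']|[m'|]] //=.
  - by move/eqP => yy'; exists (Some x'); rewrite //= -yy' addrC addKr.
  - by move/eqP <-; exists None.
  - by move/eqP ->; exists (Some y').
  - by exists None.
  - by exists (Some m').
  - by exists None.
by case: P => [[x y]|[m|]]; case: o => [t|] //=; rewrite // addrC subrK.
Qed.

Lemma card_point : #|{: point F}| = (#|F| ^ 2 + #|F| + 1)%N.
Proof. by rewrite card_sum card_prod card_option mulnn addn1 addnS. Qed.

Lemma card_polar P : #|polar P| = #|F|.+1.
Proof.
rewrite polarE card_imset ?cardsT ?card_option //.
by case: P => [[x y]|[m|]] [t|] [t'|] //= [->].
Qed.

Definition polarity_graph : rel (point F) :=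
  fun P Q => (P != Q) && conjugate_pt P Q.

Lemma polarity_graph_symmetric : symmetric polarity_graph.
Proof.
by move=> P Q; rewrite /polarity_graph eq_sym conjugate_pt_symmetric.
Qed.

Lemma polarity_graph_irreflexive : irreflexive polarity_graph.
Proof. by move=> P; rewrite /polarity_graph eqxx. Qed.

Lemma polarity_graph_C4_free : C4_free polarity_graph.
Proof. by apply: C4_free_sub conjugate_pt_C4_free => P Q /andP []. Qed.

Lemma card_nbrs_polarity_graph (A : {set point F}) P : P \notin A ->
  (#|nbrs polarity_graph P :&: ~: A| + #|polar P :&: A| + conjugate_pt P P)%N
    = #|F|.+1.
Proof.
move=> nPA.
have -> : nbrs polarity_graph P :&: ~: A = (polar P :\: A) :\ P.
  apply/setP => Q; rewrite !inE /polarity_graph eq_sym -andbA.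
  by congr (_ && _); apply: andbC.
rewrite -(card_polar P) -(cardsID A (polar P)) (cardsD1 P (polar P :\: A)).
by rewrite !inE nPA -addnA addnC -addnA.
Qed.

Lemma not_arrows_polarity_graph (A : {set point F}) (l k n c : nat) :
  (2 * c + #|A| = #|F| ^ 2 + #|F| + 1)%N -> (#|F|.+1 - l < c)%N ->
  (2 * c + k <= n + #|F| + 2)%N ->
  (forall P, P \notin A -> l <= #|polar P :&: A| + conjugate_pt P P <= k)%N ->
  ~ arrows 2 n c.
Proof.
move=> cardA ltc len degA.
apply: (@not_arrows_of_C4_free _ polarity_graph (~: A) n c
          (#|F|.+1 - k) (#|F|.+1 - l)).
- exact: polarity_graph_symmetric.
- exact: polarity_graph_irreflexive.
- exact: polarity_graph_C4_free.
- by have := cardsC A; rewrite card_point; lia.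
- by lia.
- by lia.
move=> P; rewrite inE => nPA.
by have := degA P nPA; have := card_nbrs_polarity_graph nPA; lia.
Qed.

Section Parabola.
Variable a : F.
Hypotheses (a0 : a != 0) (a4 : 4 * a = 2).

Definition parabola (t : F) : point F := inl (t, a * t ^+ 2).

Lemma parabola_inj : injective parabola.
Proof. by move=> s t []. Qed.

(* [4 a = 2] makes the polars of the absolute points tangent to the parabola. *)
Lemma card_polar_parabola P :
  (#|parabola @^-1: polar P| + conjugate_pt P P <= 2)%N.
Proof.
case: P => [[x y]|[m|]] /=; last 2 first.
- rewrite addn0 (_ : _ @^-1: _ = [set m]) ?cards1 //.
  by apply/setP => t; rewrite !inE.
- by rewrite (_ : _ @^-1: _ = set0) ?cards0 //; apply/setP => t; rewrite !inE.
have -> : parabola @^-1: polar (inl (x, y))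
    = [set t | a * t ^+ 2 + - x * t + y == 0].
  apply/setP => t; rewrite !inE /= -subr_eq0; congr (_ == _); ring.
have [yy|_] := eqVneq; last by rewrite addn0 card_quadratic_roots.
rewrite addn1 ltnS card_quadratic_double_root // sqrrN expr2 -yy.
by rewrite a4; ring.
Qed.

End Parabola.

End Polarity.

(** * The polarity in even order *)

Section EvenOrder.
Variable F : finFieldType.
Hypothesis evenF : ~~ odd #|F|.

Lemma pchar2_even_order : 2%N \in [pchar F].
Proof.
rewrite inE /= -subr_eq0 -[2]/(1 + 1) subr0 addr_eq0; apply/eqP.
by rewrite -[RHS]expf_card -signr_odd (negPf evenF) expr0.
Qed.

Definition sqrt_even (x : F) : F := x ^+ #|F|./2.

Lemma sqrt_evenK x : sqrt_even x ^+ 2 = x.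
Proof.
rewrite /sqrt_even -exprM muln2 -[RHS]expf_card.
by rewrite -[in RHS](odd_double_half #|F|) (negPf evenF).
Qed.

(* The map [t |-> - (t^2 + t)] takes the value [0] twice, so it is not onto. *)
Lemma exists_rootless_quadratic : exists a : F, forall t, t ^+ 2 + t + a != 0.
Proof.
pose f (t : F) := - (t ^+ 2 + t).
have /existsP [a aP] : [exists a, a \notin f @: [set: F]].
  rewrite -negb_forall; apply/negP => /forallP full.
  have /imset_injP inj : #|f @: [set: F]| == #|[set: F]|.
    rewrite eqn_leq leq_imset_card /=; apply: subset_leq_card.
    by apply/subsetP => x _; apply: full.
  have /eqP : (0 : F) = 1.
    apply: inj; rewrite ?inE // /f expr0n expr1n addr0.
    by rewrite (addrr_pchar2 pchar2_even_order).
  by rewrite eq_sym oner_eq0.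
exists a => t; apply: contraNneq aP => root_t; apply/imsetP; exists t => //.
by apply/esym/eqP; rewrite eqr_oppLR -addr_eq0 root_t.
Qed.

Definition absolute_pole : point F := inr (Some 0).

Definition absolute_line : {set point F} := polar absolute_pole.

Lemma absolute_in_absolute_line (P : point F) :
  conjugate_pt P P -> P \in absolute_line.
Proof.
rewrite inE; case: P => [[x y]|[m|]] //=.
by rewrite (addrr_pchar2 pchar2_even_order) eq_sym mulf_eq0 orbb.
Qed.

Lemma polar_meets_absolute_line (P : point F) :
  (0 < #|polar P :&: absolute_line|)%N.
Proof.
apply/card_gt0P; case: P => [[x y]|[m|]]; last 2 first.
- by exists (inr None); rewrite !inE.
- by exists (inr None); rewrite !inE.
by exists (inl (0, - y)); rewrite !inE /= subrr mulr0 eqxx.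
Qed.

Variable a : F.
Hypothesis rootless : forall t, t ^+ 2 + t + a != 0.

(* The conic [x^2 = y^2 + y z + a z^2]. *)
Definition elliptic (o : option F) : point F :=
  if o is Some y then inl (sqrt_even (y ^+ 2 + y + a), y) else inr (Some 1).

Lemma card_elliptic : #|elliptic @: [set: option F]| = #|F|.+1.
Proof.
rewrite card_imset ?cardsT ?card_option //.
by move=> [y|] [y'|] //= [_ ->].
Qed.

Lemma elliptic_notin_absolute_line o : elliptic o \notin absolute_line.
Proof.
rewrite inE; case: o => [y|] //=; apply: contra (rootless y) => /eqP x0.
by rewrite -[X in X == _]sqrt_evenK x0 expr0n.
Qed.

Lemma card_polar_elliptic (P : point F) : (#|elliptic @^-1: polar P| <= 2)%N.
Proof.
have sq_eq x y u : y + u = x * sqrt_even (u ^+ 2 + u + a) ->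
    (1 - x ^+ 2) * u ^+ 2 + - x ^+ 2 * u + (y ^+ 2 - a * x ^+ 2) = 0.
  move/(congr1 (fun z => z ^+ 2)); rewrite exprMn sqrt_evenK => sq.
  transitivity ((y + u) ^+ 2 - x ^+ 2 * (u ^+ 2 + u + a) - (y * u + y * u)).
    by ring.
  by rewrite sq (addrr_pchar2 pchar2_even_order) subrr subr0.
rewrite card_set_option; case: P => [[x y]|[m|]]; rewrite !inE /=; last 2 first.
- rewrite addn0.
  apply: leq_trans (card_quadratic_roots 1 (a - m ^+ 2) (oner_neq0 F)).
  apply/subset_leq_card/subsetP => u; rewrite !inE /= => /eqP <-.
  by rewrite sqrt_evenK; apply/eqP; ring.
- rewrite addn1 ltnS (_ : _ @^-1: _ = set0) ?cards0 //.
  by apply/setP => u; rewrite !inE.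
have [x1|x1] := eqVneq x 1.
  rewrite addn1 ltnS -(cards1 (y ^+ 2 - a)).
  apply/subset_leq_card/subsetP => u; rewrite !inE /= => /eqP /sq_eq.
  rewrite x1 expr1n subrr mul0r add0r mulN1r mulr1 => /eqP.
  by rewrite addrC subr_eq0 eq_sym.
have x2 : 1 - x ^+ 2 != 0.
  rewrite subr_eq0 eq_sym sqrf_eq1 negb_or x1.
  by rewrite (oppr_pchar2 pchar2_even_order).
rewrite addn0.
apply: leq_trans (card_quadratic_roots (- x ^+ 2) (y ^+ 2 - a * x ^+ 2) x2).
by apply/subset_leq_card/subsetP => u; rewrite !inE /= => /eqP /sq_eq ->.
Qed.

Definition elliptic_deletion : {set point F} :=
  absolute_pole |: (absolute_line :|: elliptic @: setT).

Lemma card_elliptic_deletion : #|elliptic_deletion| = (2 * #|F| + 3)%N.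
Proof.
have -> : #|elliptic_deletion| = (#|absolute_line :|: elliptic @: setT|.+1)%N.
  rewrite cardsU1 inE negb_or [absolute_pole \in polar _]inE /=.
  case: imsetP => // -[[y|] _] // [/eqP].
  by rewrite eq_sym oner_eq0.
have := cardsUI absolute_line (elliptic @: setT); rewrite disjoint_setI0.
  by rewrite cards0 card_polar card_elliptic; lia.
rewrite disjoint_sym disjoints_subset; apply/subsetP => _ /imsetP [o _ ->].
by rewrite in_setC elliptic_notin_absolute_line.
Qed.

Lemma card_polar_elliptic_deletion P : P \notin elliptic_deletion ->
  (1 <= #|polar P :&: elliptic_deletion| + conjugate_pt P P <= 3)%N.
Proof.
rewrite !in_setU in_set1 !negb_or => /and3P [P_pole P_line _].
rewrite (negPf (contra (@absolute_in_absolute_line P) P_line)) addn0.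
have -> : polar P :&: elliptic_deletion
    = (polar P :&: absolute_line) :|: (polar P :&: elliptic @: setT).
  rewrite -setIUr; apply/setP => Q; rewrite !in_setI in_setU1.
  case: eqVneq => //= ->.
  by move: P_line; rewrite !inE conjugate_pt_symmetric => /negPf ->.
apply/andP; split.
  apply: leq_trans (polar_meets_absolute_line P) _.
  exact/subset_leq_card/subsetUl.
rewrite (leq_trans (leq_card_setU _ _)) // -[3%N]/(1 + 2)%N leq_add //.
  by have /C4_freeP := conjugate_pt_C4_free F; apply.
exact: leq_trans (leq_card_setI_imset _ _ _) (card_polar_elliptic P).
Qed.

End EvenOrder.

(** * Lower bounds *)

Lemma exists_parabola_coefficient (F : fieldType) :
  exists2 a : F, a != 0 & 4 * a = 2.
Proof.
have [two0|two0] := eqVneq (2 : F) 0; last first.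
  by exists 2^-1; [rewrite invr_eq0 | field].
exists 1; first exact: oner_neq0.
by transitivity (2 * 2 : F); [ring | rewrite two0 mul0r].
Qed.

Lemma not_arrows_parabola (F : finFieldType) (m n c : nat) :
  (3 <= #|F|)%N -> (m <= #|F|)%N -> (2 * c + m = #|F| ^ 2 + #|F| + 1)%N ->
  (2 * c <= n + #|F|)%N -> ~ arrows 2 n c.
Proof.
move=> q3 mq cE nE.
have [a a0 a4] := exists_parabola_coefficient F.
pose A := parabola a @: [set enum_val (widen_ord mq i) | i : 'I_m].
have cardA : #|A| = m.
  rewrite (card_imset _ (@parabola_inj F a)) card_imset ?card_ord //.
  by move=> i j /enum_val_inj /(congr1 val) /= ij; apply: val_inj.
apply: (@not_arrows_polarity_graph F A 0 2 n c) => [|||P _].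
- by rewrite cardA.
- by nia.
- by lia.
apply: leq_trans (card_polar_parabola a0 a4 P).
by rewrite leq_add2r leq_card_setI_imset.
Qed.

Lemma not_arrows_elliptic (F : finFieldType) (n c : nat) :
  ~~ odd #|F| -> (4 <= #|F|)%N -> (2 * c + #|F| + 2 = #|F| ^ 2)%N ->
  (2 * c + 1 <= n + #|F|)%N -> ~ arrows 2 n c.
Proof.
move=> evenF q4 cE nE; have [a rootless] := exists_rootless_quadratic evenF.
apply: (@not_arrows_polarity_graph F (elliptic_deletion a) 1 3 n c)
  => [|||P nP].
- by rewrite card_elliptic_deletion //; nia.
- by nia.
- by lia.
exact: card_polar_elliptic_deletion.
Qed.

(** * Values of [M_2] *)

Local Close Scope ring_scope.

Lemma exists_field_of_order (q : nat) :
  prime_power q -> exists F : finFieldType, #|F| = q.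
Proof.
move=> [p [m [p_prime m0 ->]]].
by have [F _ cardF] := pPrimePowerField p_prime m0; exists F.
Qed.

Lemma is_M_parabola (q m n c : nat) : prime_power q -> 3 <= m <= q ->
  n + m = q ^ 2 + 1 -> 2 * c + m = q ^ 2 + q + 3 -> is_M 2 n c.
Proof.
move=> /exists_field_of_order [F cardF] /andP [m3 mq] nE cE.
apply: is_M_intro; [by nia | |].
  by apply: (@arrows_of_degree _ _ _ q.+1) => //; nia.
by apply: (@not_arrows_parabola F m); rewrite ?cardF; lia.
Qed.

Lemma is_M_elliptic (q n c : nat) : prime_power q -> ~~ odd q -> 4 <= q ->
  n + 2 * q + 1 = q ^ 2 -> 2 * c + q = q ^ 2 -> is_M 2 n c.
Proof.
move=> /exists_field_of_order [F cardF] evenq q4 nE cE.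
apply: is_M_intro; [by nia | |].
  by apply: (@arrows_of_degree _ _ _ q) => //; nia.
by apply: (@not_arrows_elliptic F); rewrite ?cardF //; lia.
Qed.

Theorem theoremC (q : nat) (hq : prime_power q) (hq3 : 3 <= q) :
  is_M 2 (q ^ 2 - 2) ((q ^ 2 + q) %/ 2) /\
  (~~ odd q -> 8 <= q ->
     forall k : nat, odd k -> 3 <= k -> k <= q - 3 ->
       is_M 2 (q ^ 2 - k - 1) ((q ^ 2 + q - k + 1) %/ 2)) /\
  (~~ odd q ->
     is_M 2 ((q - 1) ^ 2 - 2) (((q - 1) ^ 2 + q - 3) %/ 2 + 1)) /\
  (odd q ->
     forall k : nat, ~~ odd k -> 2 <= k -> k <= 2 * ceil_divn q 4 ->
       is_M 2 (q ^ 2 - k) ((q ^ 2 + q - k) %/ 2 + 1)).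
Proof.
have leq_sq : 3 * q <= q ^ 2 by nia.
have even_sqD : ~~ odd (q ^ 2 + q) by rewrite oddD oddX addbb.
split; [|split; [|split]].
- by apply: (@is_M_parabola q 3) => //; lia.
- by move=> _ _ k oddk k3 kq; apply: (@is_M_parabola q k.+2) => //; lia.
- move=> evenq; have sq_pred : (q - 1) ^ 2 + 2 * q = q ^ 2 + 1 by nia.
  by apply: (@is_M_elliptic q) => //; lia.
- move=> oddq k evenk k2; rewrite /ceil_divn => kq.
  by apply: (@is_M_parabola q k.+1) => //; lia.
Qed.
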